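(* Let $S \in GL_n(\mathbb{R})$ be a Perron similarity. Then $\mathcal{C}(S) = \mathcal{C}_r(S)$ if and only if $S$ is row Hadamard conic and every extremal $y$ of $\mathcal{C}(S)$ satisfies $y^\top S^{-1} \geq 0$.
   Context: All inequalities between matrices or vectors are entrywise. A matrix $S \in GL_n(\mathbb{R})$ is called a Perron similarity if there is a real, diagonal, nonscalar matrix $D$ (i.e. $D$ is not a scalar multiple of the identity) such that $S D S^{-1} \geq 0$. For $x \in \mathbb{R}^n$, $\operatorname{diag}(x)$ denotes the diagonal matrix with diagonal entries the entries of $x$. The spectracone of $S$ is $\mathcal{C}(S) := \{x \in \mathbb{R}^n : S \operatorname{diag}(x) S^{-1} \geq 0\}$; it is a polyhedral cone, i.e. a convex cone in $\mathbb{R}^n$ with finitely many extremals (up to positive scaling), where an extremal of the cone is a nonzero vector spanning an extreme ray of it. The row cone $\mathcal{C}_r(S)$ is the convex cone generated by the rows of $S$, i.e. the set of all linear combinations of the rows of $S$ with nonnegative coefficients. Row vectors and column vectors of length $n$ are identified when comparing $\mathcal{C}_r(S)$ and $\mathcal{C}(S)$ as subsets of $\mathbb{R}^n$. Let $r_1,\dots,r_n$ denote the rows of $S$ and let $\circ$ denote the Hadamard (entrywise) product. $S$ is called row Hadamard conic (RHC) if $r_i \circ r_j \in \mathcal{C}_r(S)$ for all $i,j \in \{1,\dots,n\}$. *)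

(* Defs.v *)
From HB Require Import structures.
From mathcomp Require Import all_boot all_order all_algebra.
From mathcomp Require Import boolp classical_sets reals.

Set Implicit Arguments.
Unset Strict Implicit.
Unset Printing Implicit Defensive.

Import Order.TTheory GRing.Theory Num.Theory.

Local Open Scope classical_set_scope.
Local Open Scope ring_scope.

(* Vectors of R^n are represented as row vectors, so that y^T S^-1 reads
   [y *m invmx S] and diag(x) is [diag_mx x]. *)

Definition nonneg_mx (R : realType) (m n : nat) (A : 'M[R]_(m, n)) : Prop :=
  A \is a mxOver Num.nneg.

Definition hadamard (R : realType) (m n : nat) (A B : 'M[R]_(m, n)) :
    'M[R]_(m, n) :=
  map2_mx *%R A B.

(* Invertibility is part of the definition because [invmx S] is [S] when [S] is
   singular. *)
Definition perron_similarity (R : realType) (n : nat) (S : 'M[R]_n) : Prop :=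
  S \in unitmx /\
  exists D : 'M[R]_n,
    [/\ is_diag_mx D, ~~ is_scalar_mx D & nonneg_mx (S *m D *m invmx S)].

Definition spectracone (R : realType) (n : nat) (S : 'M[R]_n) : set 'rV[R]_n :=
  [set x | nonneg_mx (S *m diag_mx x *m invmx S)].

Definition row_cone (R : realType) (n : nat) (S : 'M[R]_n) : set 'rV[R]_n :=
  [set x | exists c : 'I_n -> R,
     (forall i, 0 <= c i) /\ x = \sum_(i < n) c i *: row i S].

Definition row_hadamard_conic (R : realType) (n : nat) (S : 'M[R]_n) : Prop :=
  forall i j : 'I_n, row_cone S (hadamard (row i S) (row j S)).

Definition ray (R : realType) (n : nat) (x : 'rV[R]_n) : set 'rV[R]_n :=
  [set t *: x | t in [set t : R | 0 <= t]].

(* A face of the convex cone [K] is a subset [F] of [K] such that a sum of two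
   vectors of [K] lies in [F] only if both summands do; an extreme ray is a ray
   that is a face. *)
Definition extreme_ray (R : realType) (n : nat) (K : set 'rV[R]_n)
    (x : 'rV[R]_n) : Prop :=
  ray x `<=` K /\
  forall u v : 'rV[R]_n, K u -> K v -> ray x (u + v) -> ray x u /\ ray x v.

Definition extremal (R : realType) (n : nat) (K : set 'rV[R]_n)
    (x : 'rV[R]_n) : Prop :=
  x != 0 /\ extreme_ray K x.

(* Main.v *)
(** Writing [r_i] for the rows of [S], a vector [x] lies in the row cone iff
    [x S^-1 >= 0], and it lies in the spectracone iff every [r_i o x] lies in
    the row cone. Hence RHC says that the rows, and thus the whole row cone, lie
    in the spectracone. The spectracone is polyhedral and pointed, because
    [x |-> S diag(x) S^-1] is injective, so it is generated by its extremals;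
    it is contained in the row cone as soon as these are. *)
Require Import Defs.
From mathcomp Require Import all_boot all_order all_algebra.
From mathcomp Require Import boolp classical_sets reals.

Set Implicit Arguments.
Unset Strict Implicit.
Unset Printing Implicit Defensive.

Import Order.TTheory GRing.Theory Num.Theory.

Local Open Scope ring_scope.

Lemma nonneg_mxP (R : realType) (m n : nat) (A : 'M[R]_(m, n)) :
  nonneg_mx A <-> forall i j, 0 <= A i j.
Proof.
split=> [/mxOverP A0 i j|A0]; first by have := A0 i j; rewrite nnegrE.
by apply/mxOverP => i j; rewrite nnegrE.
Qed.

Lemma nonneg_mxD (R : realType) (m n : nat) (A B : 'M[R]_(m, n)) :
  nonneg_mx A -> nonneg_mx B -> nonneg_mx (A + B).
Proof.
move=> /nonneg_mxP A0 /nonneg_mxP B0; apply/nonneg_mxP => i j.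
by rewrite mxE addr_ge0.
Qed.

Lemma nonneg_mxZ (R : realType) (m n : nat) (t : R) (A : 'M[R]_(m, n)) :
  0 <= t -> nonneg_mx A -> nonneg_mx (t *: A).
Proof.
by move=> t0 /nonneg_mxP A0; apply/nonneg_mxP => i j; rewrite mxE mulr_ge0.
Qed.

Section PolyhedralCone.
Variables (R : realType) (n p q : nat) (L : {linear 'rV[R]_n -> 'M[R]_(p, q)}).
Hypothesis L_inj : injective L.

Let K : set 'rV[R]_n := [set x | nonneg_mx (L x)]%classic.

(** A ratio test: injectivity of [L] gives [L u] a positive entry, and [s] is the least ratio of
    entries of [L x] to positive entries of [L u]. The minimising entry drops to zero and no other
    turns negative. *)
Lemma cone_subtract_tight (x u : 'rV[R]_n) : K x -> K u -> u != 0 ->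
  exists s i j, [/\ 0 <= s, 0 < L u i j, K (x - s *: u) &
                    L (x - s *: u) i j = 0].
Proof.
move=> /nonneg_mxP x0 /nonneg_mxP u0 u_neq0.
have [[i0 j0] /= k0|no_pos] := pickP (fun k : 'I_p * 'I_q => 0 < L u k.1 k.2);
  last first.
  case/eqP: u_neq0; apply: L_inj; rewrite linear0; apply/matrixP => i j.
  rewrite mxE; apply/eqP; rewrite eq_le u0 andbT leNgt.
  by have /= -> := no_pos (i, j).
pose F (k : 'I_p * 'I_q) := L x k.1 k.2 / L u k.1 k.2.
have [[i j] /= uij Fmin] := @arg_minP _ _ _ (i0, j0) (fun k => 0 < L u k.1 k.2) F k0.
exists (F (i, j)), i, j; split=> //.
- by rewrite /F /= divr_ge0.
- apply/nonneg_mxP => a b; rewrite linearB linearZ !mxE subr_ge0.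
  have := u0 a b; rewrite le_eqVlt => /predU1P[<-|uab]; first by rewrite mulr0.
  by rewrite -ler_pdivlMr //; exact: (Fmin (a, b)).
- by rewrite linearB linearZ !mxE /F /= divfK ?subrr // gt_eqF.
Qed.

Let slack (x : 'rV[R]_n) : {pred 'I_p * 'I_q} := fun k => L x k.1 k.2 != 0.

(* A non-extremal [x] is split along a summand [u] off its ray: pushing [x]
   away from [u] until a constraint of [K] becomes tight gives [y], and pushing
   [u] away from [y] in the same way gives [z]. *)
Lemma not_extremal_split (x : 'rV[R]_n) : K x -> x != 0 -> ~ extremal K x ->
  exists y z s t, [/\ K y /\ K z, 0 <= s /\ 0 <= t, x = s *: y + t *: z,
    slack y \proper slack x & slack z \proper slack x].
Proof.
move=> Kx x_neq0 not_ext.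
have [u [v [Ku Kv [t t0 tx] u_off]]] : exists u v,
    [/\ K u, K v, ray x (u + v) & ~ ray x u].
  apply: contra_notP not_ext => no_split; split=> //; split=> [_ [t t0 <-]|].
    by rewrite /K /= linearZ; exact: nonneg_mxZ.
  move=> u v Ku Kv xuv.
  by split; apply: contra_notP no_split => off;
    [exists u, v | exists v, u; rewrite addrC].
have /nonneg_mxP u0 := Ku; have /nonneg_mxP v0 := Kv.
(* Since [t *: x = u + v] with [L u] and [L v] nonnegative, a constraint tight at [x] is tight at
   both summands. *)
have sub_ux i j : L x i j = 0 -> L u i j = 0.
  move=> xij; apply/eqP; rewrite eq_le u0 andbT.
  have: L (t *: x) i j = L (u + v) i j by rewrite tx.
  rewrite linearZ linearD !mxE xij mulr0 => /esym/eqP.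
  by rewrite addr_eq0 => /eqP ->; rewrite oppr_le0.
have u_neq0 : u != 0.
  by apply: contra_notN u_off => /eqP ->; exists 0; rewrite ?scale0r /=.
have [s [i [j [s0 uij Ky yij]]]] := cone_subtract_tight Kx Ku u_neq0.
set y := x - s *: u in Ky yij.
(* If [y] vanished, then [x = s *: u] with [s] nonzero would put [u] on the ray of [x]. *)
have y_neq0 : y != 0.
  apply: contra_notN u_off; rewrite subr_eq0 => /eqP xsu.
  have s_neq0 : s != 0.
    by apply: contraNneq x_neq0 => s_eq0; rewrite xsu s_eq0 scale0r.
  exists s^-1; first by rewrite /= invr_ge0.
  by rewrite xsu scalerA mulVf // scale1r.
have [r [k [l [r0 ykl Kz zkl]]]] := cone_subtract_tight Ku Ky y_neq0.
set z := u - r *: y in Kz zkl.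
have sub_yx a b : L x a b = 0 -> L y a b = 0.
  by move=> xab; rewrite linearB linearZ !mxE xab sub_ux // mulr0 subrr.
have sub_zx a b : L x a b = 0 -> L z a b = 0.
  by move=> xab; rewrite linearB linearZ !mxE sub_ux // sub_yx // mulr0 subrr.
(* Substitute [u = z + r *: y] into [x = y + s *: u]. *)
exists y, z, (1 + s * r), s; split=> //.
- by split=> //; rewrite addr_ge0 ?mulr_ge0.
- by rewrite /z (scalerBr s) scalerDl scale1r scalerA -addrA subrKC subrK.
- apply/properP; split.
    by apply/fintype.subsetP => -[a b]; rewrite !unfold_in; apply: contra_neq; exact: sub_yx.
  (* The constraint [(i, j)] is tight at [y] but slack at [x], as tightness at [x] would force
     [L u i j = 0]. *)
  exists (i, j); rewrite !unfold_in /= ?yij ?eqxx //.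
  by apply: contraTneq uij => /sub_ux ->; rewrite ltxx.
- apply/properP; split.
    by apply/fintype.subsetP => -[a b]; rewrite !unfold_in; apply: contra_neq; exact: sub_zx.
  exists (k, l); rewrite !unfold_in /= ?zkl ?eqxx //.
  by apply: contraTneq ykl => /sub_yx ->; rewrite ltxx.
Qed.

(* Minkowski's theorem, by induction on the number of slack constraints. *)
Lemma pointed_cone_sub_of_extremals (C : set 'rV[R]_n) :
  C 0 -> (forall x y, C x -> C y -> C (x + y)) ->
  (forall t x, 0 <= t -> C x -> C (t *: x)) ->
  (forall y, extremal K y -> C y) ->
  (K `<=` C)%classic.
Proof.
move=> C0 CD CZ Cext x; move: {-1}#|slack x|.+1 (ltnSn #|slack x|) => m.
elim: m x => // m IH x; rewrite ltnS => le_m Kx.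
have [->//|x_neq0] := eqVneq x 0.
have [/Cext//|not_ext] := pselect (extremal K x).
have [y [z [s [t [[Ky Kz] [s0 t0] xE ltyx ltzx]]]]] :=
  not_extremal_split Kx x_neq0 not_ext.
have Cy : C y by apply: IH Ky; exact: leq_trans (proper_card ltyx) le_m.
have Cz : C z by apply: IH Kz; exact: leq_trans (proper_card ltzx) le_m.
by rewrite xE; apply: CD; exact: CZ.
Qed.

End PolyhedralCone.

Section RowCone.
Variables (R : realType) (n : nat) (S : 'M[R]_n).
Hypothesis S_unit : S \in unitmx.

(** The rows of [S] form a basis, in which the coordinates of [x] are the entries of
    [x *m invmx S]. *)
Lemma row_coneP (x : 'rV[R]_n) : row_cone S x <-> nonneg_mx (x *m invmx S).
Proof.
split=> [[c [c0 ->]]|/nonneg_mxP x0].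
  have -> : \sum_i c i *: row i S = (\row_i c i) *m S.
    by rewrite mulmx_sum_row; apply: eq_bigr => i _; rewrite mxE.
  by rewrite mulmxK //; apply/nonneg_mxP => i j; rewrite mxE.
exists ((x *m invmx S) 0); split=> [i|]; first exact: x0.
by rewrite -mulmx_sum_row mulmxKV.
Qed.

Lemma row_cone_row (i : 'I_n) : row_cone S (row i S).
Proof.
apply/row_coneP; rewrite -row_mul mulmxV //; apply/nonneg_mxP => a b.
by rewrite !mxE ler0n.
Qed.

(** Row [i] of [S *m diag_mx x] is the Hadamard product of row [i] of [S] with [x], so the criterion
    for the row cone applies row by row. *)
Lemma spectraconeP (x : 'rV[R]_n) :
  spectracone S x <-> forall i, row_cone S (hadamard (row i S) x).
Proof.
have rowE i : row i (S *m diag_mx x) = hadamard (row i S) x.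
  by apply/rowP => j; rewrite mul_mx_diag !mxE.
split=> [/nonneg_mxP x0 i|x0].
  apply/row_coneP; rewrite -rowE -row_mul.
  by apply/nonneg_mxP => a b; rewrite mxE.
apply/nonneg_mxP => i j; have /row_coneP/nonneg_mxP/(_ 0 j) := x0 i.
by rewrite -rowE -row_mul mxE.
Qed.

Let spec_map : {linear 'rV[R]_n -> 'M[R]_n} :=
  mulmxr (invmx S) \o (mulmx S \o @diag_mx R n).

Lemma spectracone_sub_of_extremals (C : set 'rV[R]_n) :
  C 0 -> (forall x y, C x -> C y -> C (x + y)) ->
  (forall t x, 0 <= t -> C x -> C (t *: x)) ->
  (forall y, extremal (spectracone S) y -> C y) ->
  (spectracone S `<=` C)%classic.
Proof.
(* It remains to show [spec_map] injective: cancelling [S] and its inverse recovers [diag_mx x],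
   hence [x]. *)
apply: (@pointed_cone_sub_of_extremals _ _ _ _ spec_map) => x y /= xy.
have /matrixP dxy : diag_mx x = diag_mx y.
  apply: (can_inj (mulKmx S_unit)).
  by have := congr1 (mulmx^~ S) xy; rewrite !mulmxKV.
by apply/rowP => i; have := dxy i i; rewrite !mxE eqxx !mulr1n.
Qed.

Lemma row_cone_sub_spectracone :
  row_hadamard_conic S -> (row_cone S `<=` spectracone S)%classic.
Proof.
move=> rhc _ [c [c0 ->]].
apply: (big_ind (spectracone S)) => [|x y Kx Ky|i _] /=.
- by rewrite /spectracone /= linear0 mulmx0 mul0mx; apply/nonneg_mxP => i j;
    rewrite mxE.
- by rewrite /spectracone /= linearD mulmxDr mulmxDl; exact: nonneg_mxD.
- rewrite /spectracone /= linearZ -scalemxAr -scalemxAl; apply: nonneg_mxZ => //.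
  by apply/spectraconeP => j; exact: rhc.
Qed.

End RowCone.

Theorem theorem3p9 (R : realType) (n : nat) (S : 'M[R]_n)
    (hS : perron_similarity S) :
  spectracone S = row_cone S <->
  row_hadamard_conic S /\
  (forall y : 'rV[R]_n, extremal (spectracone S) y -> nonneg_mx (y *m invmx S)).
Proof.
have [S_unit _] := hS; split=> [CE|[rhc ext]].
  split=> [i j|y [_ [ray_sub _]]].
    (* Row [j] lies in the row cone, hence in the spectracone, so its product with row [i] is back
       in the row cone. *)
    by apply: (spectraconeP S_unit _).1; rewrite CE; exact: row_cone_row.
  apply/(row_coneP S_unit); rewrite -CE; apply: ray_sub.
  by exists 1; rewrite ?scale1r //= ler01.
rewrite eqEsubset; split; last exact: row_cone_sub_spectracone.
apply: spectracone_sub_of_extremals => //.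
- by apply/(row_coneP S_unit); rewrite mul0mx; apply/nonneg_mxP => i j; rewrite mxE.
- move=> x y /(row_coneP S_unit) x0 /(row_coneP S_unit) y0.
  by apply/(row_coneP S_unit); rewrite mulmxDl; exact: nonneg_mxD.
- move=> t x t0 /(row_coneP S_unit) x0.
  by apply/(row_coneP S_unit); rewrite -scalemxAl; exact: nonneg_mxZ.
- by move=> y /ext/(row_coneP S_unit).
Qed.
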